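(* There is an absolute constant $c > 0$ such that for all positive integers $n, k$ with $k \le n$, \[ \mathsf{CC}_k(\mathrm{Maj}_n) \geq c \cdot \frac{n}{k} \cdot \min\!\Big(\log k, \log \frac{n}{k}\Big). \]
   Context: $\mathrm{Maj}_n : \{0,1\}^n \to \{0,1\}$ outputs $1$ if $x_1 + \cdots + x_n \geq n/2$ and $0$ otherwise. A function $g : \{0,1\}^n \to \{0,1\}$ is $k$-local if there is a set $I \subseteq [n]$ with $|I| = k$ such that $g$ depends only on the variables in $I$. The $k$-composition complexity $\mathsf{CC}_k(f)$ of $f : \{0,1\}^n \to D$ is the minimum $m$ such that $f(x) = h(g_1(x), \ldots, g_m(x))$ for all $x$, for some $k$-local $g_1, \ldots, g_m : \{0,1\}^n \to \{0,1\}$ and some $h : \{0,1\}^m \to D$. Logarithms are base 2. *)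

(* Defs.v *)
From HB Require Import structures.
From mathcomp Require Import all_boot all_order all_algebra.
From mathcomp Require Import boolp classical_sets reals exp.

Set Implicit Arguments.
Unset Strict Implicit.
Unset Printing Implicit Defensive.

Definition cube (n : nat) : Type := {ffun 'I_n -> bool}.

(* [x_1 + ... + x_n >= n/2], with the denominator cleared. *)
Definition Maj (n : nat) (x : cube n) : bool :=
  n <= 2 * \sum_(i < n) (x i : nat).

Definition depends_only_on (n : nat) (I : {set 'I_n}) (g : cube n -> bool) :
    Prop :=
  forall x y : cube n, (forall i, i \in I -> x i = y i) -> g x = g y.

Definition local (k n : nat) (g : cube n -> bool) : Prop :=
  exists I : {set 'I_n}, #|I| = k /\ depends_only_on I g.

Definition composition (k n : nat) (D : Type) (f : cube n -> D) (m : nat) :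
    Prop :=
  exists (g : 'I_m -> cube n -> bool) (h : cube m -> D),
    (forall j, local k (g j)) /\ forall x, f x = h [ffun j => g j x].

Definition is_minimum (P : nat -> Prop) (m : nat) : Prop :=
  P m /\ forall m', P m' -> m <= m'.

(* The default value 0 is only reached when no composition exists, which does
   not happen for 0 < k <= n: see [CC_is_minimum]. *)
Definition CC (k n : nat) (D : Type) (f : cube n -> D) : nat :=
  xget 0 (is_minimum (composition k f)).

Lemma local_coord (k n : nat) (i : 'I_n) :
  0 < k <= n -> local k (fun x : cube n => x i).
Proof.
case/andP=> k0 kn.
have kn' : k.-1 <= #|[set~ i]|.
  by rewrite cardsC1 card_ord -ltnS !prednK // (leq_trans k0 kn).
have [A [sA cA]] : exists A : {set 'I_n}, A \subset [set~ i] /\ #|A| = k.-1.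
  pose s := take k.-1 (enum [set~ i]).
  have us : uniq s by rewrite take_uniq // enum_uniq.
  exists [set:: s]; split.
    by apply/fintype.subsetP => j; rewrite inE => /mem_take; rewrite mem_enum.
  by rewrite cardsE (card_uniqP us) size_takel // -cardE.
exists (i |: A); split; last by move=> x y; apply; rewrite setU11.
have iA : i \notin A by apply/negP => /(fintype.subsetP sA); rewrite !inE eqxx.
by rewrite cardsU1 cA iA add1n prednK.
Qed.

Lemma CC_is_minimum (k n : nat) (D : Type) (f : cube n -> D) :
  0 < k <= n -> is_minimum (composition k f) (CC k f).
Proof.
move=> kn; apply: xgetPex.
have ex : exists m, `[< composition k f m >].
  exists n; apply/asboolP; exists (fun i x => x i), f.
  split; first by move=> j; apply: local_coord.
  by move=> x; congr f; apply/ffunP => i; rewrite ffunE.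
case: (ex_minnP ex) => m /asboolP Pm minm; exists m.
by split=> // m' Pm'; apply/minm/asboolP.
Qed.

Definition log2 (R : realType) (x : R) : R := (ln x / ln 2)%R.

(* Main.v *)
Require Import Defs.
From mathcomp Require Import all_boot all_order all_algebra.
From mathcomp Require Import reals.
From mathcomp Require Import sequences exp.
From mathcomp Require Import ring lra zify.

(** Counting is hard: suppose the values of [m] functions determine [#|x|] and
each variable [i] is read by at most [d] of them.  Fix the values of the
functions not reading [i]; the code then ranges over at most [2 ^ d] words, and
switching [x_i] on strictly increases the rank of the current word when words
are ordered by the Hamming weight they encode.  So the rank, which is less than
[2 ^ d], has correlation at least about [2 ^- d] with [x_i].  But [m] bits can
only carry total squared correlation [O(m)] with the variables, whence
[n <= O(4 ^ d * m)].

From counting to majority: for some set [U] of functions, about [n / 4 ^ d]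
variables are read only by [U] and as many only by its complement.  Freezing
all others, the second group moves the threshold without affecting [U], so [U]
counts the first group.  With [d] about twice the average [m * k / n] this gives
[k <= 2 ^ O(d)], unless [d * k] is already of order [n]. *)

Set Implicit Arguments.
Unset Strict Implicit.
Unset Printing Implicit Defensive.

Import Order.TTheory GRing.Theory Num.Theory.
Local Open Scope ring_scope.

(** * Codes that determine cardinality *)

(** With [q = 1 - t + 2 * t ^+ 2], the inverse of the left side is at least [q], and [(1 + t) * q =
    1 + t ^+ 2 * (1 + 2 * t) >= 1]. *)
Lemma expR_le1Dx (R : realType) (t : R) :
  - 2^-1 <= t -> expR (t - 2 * t ^+ 2) <= 1 + t.
Proof.
move=> ht.
have q0 : 0 < 1 - (t - 2 * t ^+ 2) by nra.
have hq : 1 - (t - 2 * t ^+ 2) <= expR (- (t - 2 * t ^+ 2)).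
  exact: expR_ge1Dx.
have eq1 : expR (t - 2 * t ^+ 2) * expR (- (t - 2 * t ^+ 2)) = 1.
  by rewrite -expRD subrr expR0.
have e0 := expR_gt0 (t - 2 * t ^+ 2).
have h1 : expR (t - 2 * t ^+ 2) * (1 - (t - 2 * t ^+ 2)) <= 1.
  by rewrite -[leRHS]eq1 ler_wpM2l // ltW.
rewrite -(ler_pM2r q0); apply: (le_trans h1).
have h2 : 0 <= t ^+ 2 * (1 + 2 * t) by rewrite mulr_ge0 ?sqr_ge0 //; lra.
suff -> : (1 + t) * (1 - (t - 2 * t ^+ 2)) = 1 + t ^+ 2 * (1 + 2 * t) by lra.
by ring.
Qed.

Section CardinalityCode.
Variables (R : realType) (I J : finType) (C : {set I} -> {set J}).
Variables (nb : I -> {set J}) (d : nat).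
Hypothesis nb_d : forall i, (#|nb i| <= d)%N.
Hypothesis nbP : forall i A j, j \notin nb i -> (j \in C (i |: A)) = (j \in C A).
Hypothesis C_card : forall A B, C A = C B -> #|A| = #|B|.

(** Well defined on codes by [C_card]. Words that are not codes get weight 0; this is harmless,
    since only the strict rise between two codes matters. *)
Let wt (c : {set J}) : nat := oapp (fun A : {set I} => #|A|) 0%N [pick A | C A == c].

Let wtE (A : {set I}) : wt (C A) = #|A|.
Proof.
rewrite /wt; case: pickP => [B /eqP/C_card <- //|/(_ A)].
by rewrite eqxx.
Qed.

Let lower i (c : {set J}) :=
  [set c' : {set J} | (c' :\: nb i == c :\: nb i) && (wt c' < wt c)%N].

Let rk i c : R := #|lower i c|%:R / 2 ^+ d.

Let lower_card i c : (#|lower i c| <= 2 ^ d)%N.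
Proof.
apply: leq_trans (_ : 2 ^ #|nb i| <= _)%N; last by rewrite leq_exp2l.
rewrite -card_powerset.
have inj : {in lower i c &, injective (fun c' => c' :&: nb i)}.
  move=> c1 c2; rewrite !inE => /andP[/eqP e1 _] /andP[/eqP e2 _] e.
  by rewrite -(setID c1 (nb i)) -(setID c2 (nb i)) e e1 e2.
rewrite -(card_in_imset inj); apply/subset_leq_card/subsetP => x.
by case/imsetP=> c' _ ->; rewrite powersetE subsetIr.
Qed.

Let rk_ge0 i c : 0 <= rk i c.
Proof. by rewrite divr_ge0 // exprn_ge0. Qed.

Let rk_le1 i c : rk i c <= 1.
Proof.
by rewrite ler_pdivrMr ?exprn_gt0 // mul1r -natrX ler_nat lower_card.
Qed.

(** The two codes agree off [nb i], so they are compared with the same words; the weight rises, so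
    [C A] itself joins the lower set. *)
Let rk_step i (A : {set I}) :
  i \notin A -> (2 ^+ d)^-1 <= rk i (C (i |: A)) - rk i (C A).
Proof.
move=> iA; rewrite /rk -mulrBl ler_peMl ?invr_ge0 ?exprn_ge0 //.
rewrite lerBrDl natr1 ler_nat.
have lt : (wt (C A) < wt (C (i |: A)))%N by rewrite !wtE cardsU1 iA.
have off : C A :\: nb i = C (i |: A) :\: nb i.
  by apply/setP => j; rewrite !inE; case: (boolP (j \in nb i)) => //= /nbP ->.
have nl : C A \notin lower i (C A) by rewrite inE ltnn andbF.
have -> : #|lower i (C A)|.+1 = #|C A |: lower i (C A)| by rewrite cardsU1 nl.
apply/subset_leq_card/subsetP => c; rewrite !inE => /orP[/eqP ->|].
  by rewrite off eqxx.
by case/andP=> /eqP -> /ltn_trans -> //; rewrite off eqxx.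
Qed.

Let chi i (A : {set I}) : R := if i \in A then 1 else -1.

Let toggle i (A : {set I}) := if i \in A then A :\ i else i |: A.

Let toggleK i : involutive (toggle i).
Proof.
move=> A; rewrite /toggle; case: (boolP (i \in A)) => iA.
  by rewrite setD11 setD1K.
by rewrite setU11 setU1K.
Qed.

(** Pairing [A] with [toggle i A] flips the sign [chi], so twice the sum is a sum of rank
    differences, each bounded below by [rk_step]. *)
Let corr i :
  #|{set I}|%:R / 2 ^+ d <= 2 * \sum_(A : {set I}) chi i A * rk i (C A).
Proof.
have e : \sum_(A : {set I}) chi i A * rk i (C A) =
         \sum_(A : {set I}) - chi i A * rk i (C (toggle i A)).
  rewrite (reindex_inj (inv_inj (toggleK i))); apply: eq_bigr => A _.
  congr (_ * _); rewrite /chi /toggle; case: (boolP (i \in A)) => iA.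
    by rewrite setD11.
  by rewrite setU11 opprK.
have -> (s : R) : 2 * s = s + s by ring.
rewrite {2}e -big_split /=.
rewrite mulr_natl -sumr_const; apply: ler_sum => A _.
rewrite /chi /toggle; case: ifP => iA.
  have := @rk_step i (A :\ i); rewrite setD11 setD1K //= => /(_ isT).
  by lra.
by have := rk_step (negbT iA); lra.
Qed.

(* The exponential moment of a linear form with signs depending on the code
   costs only a factor [2 ^ #|J|], by summing over all possible codes. *)
Lemma card_code_bound : (#|I| <= 32 * 4 ^ d * #|J|)%N.
Proof.
(* Since [e * 2 ^+ d = 1/8], the linear gain [#|I| / 16] beats the quadratic loss [#|I| / 32] in the
   final comparison. *)
pose e : R := (8 * 2 ^+ d)^-1.
have p0 : 0 < 2 ^+ d :> R by rewrite exprn_gt0.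
have p1 : 1 <= 2 ^+ d :> R by rewrite exprn_ege1 // ler1n.
have e0 : 0 < e by rewrite invr_gt0 mulr_gt0.
have e8 : e <= 8^-1 by rewrite lef_pV2 ?posrE ?mulr_gt0 //; lra.
pose t i c A : R := e * (chi i A * rk i c).
have tN i c A : - e <= t i c A <= e.
  have [r0 r1] := (rk_ge0 i c, rk_le1 i c).
  by rewrite /t /chi; case: ifP => _; nra.
have t2 i c A : t i c A ^+ 2 <= e ^+ 2.
  by have /andP[h1 h2] := tN i c A; nra.
(* The quadratic term is the loss in [expR_le1Dx]; subtracting [#|J|] pays for the sum over all
   [2 ^ #|J|] words. *)
pose y (A : {set I}) : R :=
  \sum_i (t i (C A) A - 2 * t i (C A) A ^+ 2) - #|J|%:R.
have card2 : #|{set I}| = (2 ^ #|I|)%N.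
  by rewrite -[LHS]cardsT -powersetT card_powerset cardsT.
have cardJ : #|{set J}| = (2 ^ #|J|)%N.
  by rewrite -[LHS]cardsT -powersetT card_powerset cardsT.
(* For a fixed word the factors are independent, and the two choices for [i] average to 1. *)
have sumP c : \sum_(A : {set I}) \prod_i (1 + t i c A) = 2 ^+ #|I|.
  rewrite (eq_bigr (fun A : {set I} => \prod_i
    (if i \in A then 1 + e * rk i c else 1 - e * rk i c))); last first.
    move=> A _; apply: eq_bigr => i _; rewrite /t /chi.
    by case: ifP => _; ring.
  rewrite -bigA_distr -prodr_const; apply: eq_bigr => i _.
  by rewrite /=; ring.
have eJ : expR (- #|J|%:R) <= (2 ^+ #|J|)^-1 :> R.
  rewrite expRN lef_pV2 ?posrE ?expR_gt0 ?exprn_gt0 //.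
  rewrite -[X in expR X]mulr1 expRM_natl lerXn2r ?nnegrE ?expR_ge0 //.
  exact: (expR_ge1Dx 1).
have prod_ge0 c A : 0 <= \prod_i (1 + t i c A).
  by apply: prodr_ge0 => i _; have /andP[h1 h2] := tN i c A; lra.
have expy A : expR (y A) <= (2 ^+ #|J|)^-1 * \prod_i (1 + t i (C A) A).
  rewrite expRD mulrC; apply: ler_pM; rewrite ?expR_ge0 //.
  rewrite expR_sum; apply: ler_prod => i _; rewrite expR_ge0 /=.
  by apply: expR_le1Dx; have /andP[h1 h2] := tN i (C A) A; lra.
have sumexp : \sum_(A : {set I}) expR (y A) <= 2 ^+ #|I|.
  apply: le_trans (_ : \sum_(A : {set I}) (2 ^+ #|J|)^-1 *
      \sum_(c : {set J}) \prod_i (1 + t i c A) <= _).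
    apply: ler_sum => A _; apply: (le_trans (expy A)).
    rewrite ler_pM2l ?invr_gt0 ?exprn_gt0 // (bigD1 (C A)) //= lerDl.
    by apply: sumr_ge0 => c _.
  rewrite -mulr_sumr exchange_big /= (eq_bigr _ (fun c _ => sumP c)).
  by rewrite sumr_const cardJ -[_ *+ (2 ^ _)%N]mulr_natl natrX mulKf //
    expf_neq0 ?pnatr_eq0.
(* Convexity, as [1 + y <= expR y], turns the exponential bound into a nonpositive mean. *)
have sumy : \sum_(A : {set I}) y A <= 0.
  have : \sum_(A : {set I}) (1 + y A) <= 2 ^+ #|I|.
    by apply: le_trans sumexp; apply: ler_sum => A _; exact: expR_ge1Dx.
  rewrite big_split /= sumr_const card2 natrX; lra.
pose M : R := 2 ^+ #|I|.
have M0 : 0 < M by rewrite exprn_gt0.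
have sumt : e * (#|I|%:R * (M / 2 ^+ d)) <=
    2 * \sum_(A : {set I}) \sum_i t i (C A) A.
  rewrite exchange_big /= [leRHS]mulr_sumr [_%:R * _]mulr_natl -sumr_const.
  rewrite [leLHS]mulr_sumr; apply: ler_sum => i _.
  rewrite -mulr_sumr [leRHS]mulrCA ler_pM2l //.
  by have := corr i; rewrite card2 natrX.
have lowy : \sum_(A : {set I}) (\sum_i t i (C A) A) -
    M * (#|I|%:R * (2 * e ^+ 2) + #|J|%:R) <= \sum_(A : {set I}) y A.
  rewrite /M -natrX -card2 mulr_natl -sumr_const -sumrB; apply: ler_sum => A _.
  rewrite /y big_split /= sumrN.
  suff : \sum_i 2 * t i (C A) A ^+ 2 <= #|I|%:R * (2 * e ^+ 2) by lra.
  rewrite mulr_natl -sumr_const; apply: ler_sum => i _.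
  by have := t2 i (C A) A; lra.
have main : e * (#|I|%:R * (M / 2 ^+ d)) <=
    2 * (M * (#|I|%:R * (2 * e ^+ 2) + #|J|%:R)) by lra.
have {}main : #|I|%:R <= 32 * 4 ^+ d * #|J|%:R :> R.
  have pe : e * 2 ^+ d = 8^-1.
    by rewrite /e invfM -mulrA mulVf ?mulr1 // gt_eqF.
  have q : 4 ^+ d = 2 ^+ d * 2 ^+ d :> R by rewrite -exprMn; congr (_ ^+ _); ring.
  have hM : 2^-1 * (e * 2 ^+ d * #|I|%:R) <=
     2 * (#|I|%:R * (e * 2 ^+ d) ^+ 2) + 4 ^+ d * #|J|%:R.
    rewrite -(ler_pM2r M0).
    have := ler_wpM2r (ltW (mulr_gt0 p0 p0)) main.
    have -> : e * (#|I|%:R * (M / 2 ^+ d)) * (2 ^+ d * 2 ^+ d) =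
              e * 2 ^+ d * #|I|%:R * M by field; rewrite gt_eqF.
    by rewrite q; nra.
  by rewrite pe in hM; lra.
by rewrite -(ler_nat R) !natrM natrX.
Qed.

End CardinalityCode.

(** * Separating variables by a set of functions *)

Lemma exists_subset_card (T : finType) (A : {set T}) (k : nat) :
  (k <= #|A|)%N -> exists2 B : {set T}, B \subset A & #|B| = k.
Proof.
move=> kA; pose s := take k (enum A).
have us : uniq s by rewrite take_uniq // enum_uniq.
exists [set:: s].
  by apply/subsetP => x; rewrite inE => /mem_take; rewrite mem_enum.
by rewrite cardsE (card_uniqP us) size_takel // -cardE.
Qed.

(** Adding to [X] any subset of the complement of [X :|: Y] gives such a [U]: a uniformly random [U]
    works with probability at least [4 ^- d]. *)
Lemma card_separators (B : finType) (X Y : {set B}) (d : nat) :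
  (#|X| <= d)%N -> (#|Y| <= d)%N -> [disjoint X & Y] ->
  (2 ^ #|B| <= 4 ^ d * #|[set U : {set B} | X \subset U & [disjoint Y & U]]|)%N.
Proof.
move=> Xd Yd dXY.
have inj : {in powerset (~: (X :|: Y)) &, injective (fun W => X :|: W)}.
  have nW (W : {set B}) b : W \subset ~: (X :|: Y) -> b \in X -> b \in W = false.
    move=> /subsetP h bX; apply/negP => /h.
    by rewrite !inE bX.
  move=> W1 W2; rewrite !powersetE => h1 h2 /setP e; apply/setP => b.
  have := e b; rewrite !inE; case: (boolP (b \in X)) => //= bX _.
  by rewrite (nW W1) ?(nW W2).
apply: leq_trans (_ : 4 ^ d * 2 ^ #|~: (X :|: Y)| <= _)%N; last first.
  rewrite leq_mul2l -card_powerset -(card_in_imset inj).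
  apply/orP; right; apply/subset_leq_card/subsetP => U /imsetP[W].
  rewrite powersetE => WXY ->; rewrite inE subsetUl /=.
  rewrite -setI_eq0 setIUr setU_eq0 !setI_eq0 disjoint_sym dXY /=.
  by rewrite disjoint_sym disjoints_subset (subset_trans WXY) // setCS subsetUr.
have -> : (4 ^ d = 2 ^ (d + d))%N by rewrite addnn -mul2n expnM.
rewrite -expnD leq_exp2l // -(cardsC (X :|: Y)) leq_add2r.
by apply: leq_trans (leq_card_setU _ _).1 _; rewrite leq_add.
Qed.

(** Averaging over all [U]: each [i] in [D] has at least [#|D| - e] partners with disjoint [r], and
    each such pair is separated with probability at least [4 ^- d]. *)
Lemma exists_separator (I B : finType) (D : {set I}) (r : I -> {set B})
    (d e : nat) :
  {in D, forall i, #|r i| <= d}%N ->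
  {in D, forall i, #|[set i' in D | ~~ [disjoint r i & r i']]| <= e}%N ->
  exists U : {set B}, (#|D| * (#|D| - e) <=
    4 ^ d * (#|[set i in D | r i \subset U]| *
             #|[set i in D | [disjoint r i & U]]|))%N.
Proof.
move=> rd re; apply/existsP; apply: contraT; rewrite negb_exists => /forallP all.
set K := (#|D| * _)%N in all *.
pose F (U : {set B}) := (#|[set i in D | r i \subset U]| *
             #|[set i in D | [disjoint r i & U]]|)%N.
have lt U : (4 ^ d * F U < K)%N by rewrite ltnNge all.
have FE U : F U = (\sum_(i in D) \sum_(i' in D)
    ((r i \subset U) && [disjoint r i' & U] : nat))%N.
  rewrite /F -!sum1_card big_distrlr /= big_mkcond [RHS]big_mkcond /=.
  apply: eq_bigr => i _; rewrite inE.
  case: (i \in D) => //=; case: (r i \subset U) => /=; last by rewrite big1.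
  rewrite big_mkcond [RHS]big_mkcond; apply: eq_bigr => i' _; rewrite inE.
  by case: (i' \in D) => //=; case: [disjoint _ & _].
have low : (K * 2 ^ #|B| <= \sum_(U : {set B}) 4 ^ d * F U)%N.
  rewrite -big_distrr /= (eq_bigr _ (fun U _ => FE U)).
  rewrite exchange_big /= big_distrr /=.
  rewrite /K -mulnA -sum_nat_const; apply: leq_sum => i iD.
  rewrite exchange_big /= big_distrr /=.
  apply: leq_trans (_ : \sum_(i' in D | [disjoint r i & r i']) 2 ^ #|B| <= _)%N.
    rewrite sum_nat_const leq_mul2r; apply/orP; right.
    have := re i iD; rewrite leq_subLR.
    rewrite -(leq_add2r #|[set i' in D | [disjoint r i & r i']]|).
    set a := #|_|; set b := #|_| => h.
    have -> : #|[pred i' | (i' \in D) && [disjoint r i & r i']]| = b.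
      by rewrite /b cardsE.
    apply: leq_trans h; rewrite /a /b -cardsUI.
    apply: leq_trans (leq_addr _ _); apply/subset_leq_card/subsetP => i' i'D.
    by rewrite !inE i'D /=; case: [disjoint _ & _].
  rewrite big_mkcondr /=; apply: leq_sum => i' i'D; case: ifP => // dj.
  apply: leq_trans (card_separators (rd i iD) (rd i' i'D) dj) _.
  by rewrite leq_mul2l -sum1dep_card big_mkcond leqnn orbT.
have K0 : (0 < K)%N by apply: leq_ltn_trans (lt set0).
have : (\sum_(U : {set B}) 4 ^ d * F U <= \sum_(U : {set B}) K.-1)%N.
  by apply: leq_sum => U _; rewrite -ltnS prednK.
rewrite sum_nat_const (_ : #|_| = 2 ^ #|B|)%N; last first.
  by rewrite -[LHS]cardsT -powersetT card_powerset cardsT.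
move/(leq_trans low); rewrite mulnC leq_pmul2l ?expn_gt0 //.
by case: (K) K0 => // K' _; rewrite /= ltnn.
Qed.

(** * Compositions computing majority *)

Definition indic (n : nat) (X : {set 'I_n}) : cube n := [ffun i => i \in X].

Lemma Maj_indic (n : nat) (X : {set 'I_n}) : Maj (indic X) = (n <= 2 * #|X|)%N.
Proof.
rewrite /Maj -sum1_card [in RHS]big_mkcond /=; congr (_ <= 2 * _)%N.
by apply: eq_bigr => i _; rewrite ffunE; case: (i \in X).
Qed.

Section MajorityComposition.
Variables (n m k : nat) (g : 'I_m -> cube n -> bool) (h : cube m -> bool).
Variable S : 'I_m -> {set 'I_n}.
Hypothesis gS : forall j, depends_only_on (S j) (g j).
Hypothesis Sk : forall j, #|S j| = k.
Hypothesis gh : forall x, Maj x = h [ffun j => g j x].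

Let readers i := [set j | i \in S j].

Let eq_query j (X Y : {set 'I_n}) :
  {in S j, X =i Y} -> g j (indic X) = g j (indic Y).
Proof. by move=> XY; apply: gS => i /XY; rewrite !ffunE. Qed.

Let eq_threshold (X Y : {set 'I_n}) :
  (forall j, g j (indic X) = g j (indic Y)) ->
  (n <= 2 * #|X|)%N = (n <= 2 * #|Y|)%N.
Proof.
move=> XY; rewrite -!Maj_indic !gh; congr h.
by apply/ffunP => j; rewrite !ffunE.
Qed.

Let readers_neq0 i : readers i != set0.
Proof.
apply/negP => /eqP ri0; have n0 : (0 < n)%N := leq_ltn_trans (leq0n i) (ltn_ord i).
(* [B] lies one below the threshold, so adding the unread [i] would change the majority
   unnoticed. *)
have [|B sB cB] := @exists_subset_card _ [set~ i] (uphalf n).-1.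
  by rewrite cardsC1 card_ord; lia.
have iB : i \notin B by apply/negP => /(subsetP sB); rewrite !inE eqxx.
have : (n <= 2 * #|B|)%N = (n <= 2 * #|i |: B|)%N.
  apply: eq_threshold => j; apply: eq_query => l lj.
  rewrite !inE; case: eqP => // li.
  by have := in_set0 j; rewrite -ri0 inE -li lj.
by rewrite cardsU1 iB cB; lia.
Qed.

(* Setting [T2] variables shifts the threshold without being noticed by [U],
   so the functions in [U] must count the ones in [T1] exactly. *)
Let counting (U : {set 'I_m}) (T1 T2 : {set 'I_n}) :
  #|T1| = #|T2| -> [disjoint T1 & T2] ->
  {in T1, forall i, readers i \subset U} ->
  {in T2, forall i, [disjoint readers i & U]} ->
  exists F : {set 'I_n}, forall A B : {set 'I_n}, A \subset T1 -> B \subset T1 ->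
    {in U, forall j, g j (indic (A :|: F)) = g j (indic (B :|: F))} ->
    #|A| = #|B|.
Proof.
move=> T12 dT rT1 rT2.
have cT : (#|T1 :|: T2| = 2 * #|T1|)%N.
  by rewrite cardsU (disjoint_setI0 dT) cards0 subn0 -T12 mul2n addnn.
have cC : (#|~: (T1 :|: T2)| = n - 2 * #|T1|)%N by rewrite cardsCs setCK card_ord cT.
have le_n : (2 * #|T1| <= n)%N by rewrite -cT -[leqRHS]card_ord max_card.
(* This size makes [F] together with [#|T1|] further elements meet the threshold [uphalf n]
   exactly. *)
have [|F sF cF] := @exists_subset_card _ (~: (T1 :|: T2)) (uphalf n - #|T1|).
  by rewrite cC; lia.
exists F.
have notU i j : i \in T1 -> j \notin U -> i \notin S j.
  by move=> /rT1/subsetP h1; apply: contra => iS; apply: h1; rewrite inE.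
have notT2 i j : i \in T2 -> j \in U -> i \notin S j.
  move=> /rT2 dj jU; apply/negP => iS.
  by have := disjointFl dj jU; rewrite inE iS.
suff main (A B : {set 'I_n}) : A \subset T1 -> B \subset T1 ->
    {in U, forall j, g j (indic (A :|: F)) = g j (indic (B :|: F))} ->
    (#|B| <= #|A|)%N.
  move=> A B sA sB AB; apply/eqP; rewrite eqn_leq !main // => j jU.
  by rewrite AB.
move=> sA sB AB; rewrite leqNgt; apply/negP => ltAB.
have leB : (#|B| <= #|T1|)%N by apply: subset_leq_card.
(* Adding [P] puts [B :|: F] exactly at the threshold and leaves the smaller [A :|: F] below it. *)
have [|P sP cP] := @exists_subset_card _ T2 (#|T1| - #|B|).
  by rewrite -T12 leq_subr.
have cardX (X : {set 'I_n}) : X \subset T1 ->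
    (#|X :|: F :|: P| = #|X| + (uphalf n - #|T1|) + (#|T1| - #|B|))%N.
  move=> sX; rewrite -cF -cP.
  have dXF : [disjoint X & F].
    rewrite disjoint_sym disjoints_subset (subset_trans sF) // setCS.
    by rewrite (subset_trans sX) // subsetUl.
  have dXP : [disjoint X :|: F & P].
    rewrite disjoint_sym disjoints_subset (subset_trans sP) //.
    apply/subsetP => i iT2; rewrite !inE negb_or; apply/andP; split.
      by apply/negP => /(subsetP sX) iT1; have := disjointFr dT iT1; rewrite iT2.
    by apply/negP => /(subsetP sF); rewrite !inE iT2 orbT.
  by rewrite !cardsU (disjoint_setI0 dXP) (disjoint_setI0 dXF) !cards0 !subn0.
have dropP (X : {set 'I_n}) j : j \in U ->
    g j (indic (X :|: F :|: P)) = g j (indic (X :|: F)).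
  move=> jU; apply: eq_query => i iS; rewrite !inE.
  case: (boolP (i \in P)) => [/(subsetP sP) iT2|]; last by rewrite orbF.
  by have := notT2 i j iT2 jU; rewrite iS.
have : (n <= 2 * #|A :|: F :|: P|)%N = (n <= 2 * #|B :|: F :|: P|)%N.
  (* Functions in [U] do not read [P], and those outside [U] do not read [T1], so none sees a
     difference. *)
  apply: eq_threshold => j; case: (boolP (j \in U)) => jU.
    by rewrite !dropP // AB.
  apply: eq_query => i iS; rewrite !inE; congr (_ || _ || _).
  have iT1 : i \notin T1 by apply/negP => /notU/(_ jU); rewrite iS.
  by apply/idP/idP => [/(subsetP sA)|/(subsetP sB)]; rewrite (negbTE iT1).
by rewrite !cardX //; lia.
Qed.

(** The answers of the functions in [U] on [A :|: F] form a code of [A] that determines [#|A|], so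
    [card_code_bound] applies. *)
Lemma counting_bound (R : realType) (d : nat) (U : {set 'I_m})
    (T1 T2 : {set 'I_n}) :
  #|T1| = #|T2| -> [disjoint T1 & T2] ->
  {in T1, forall i, readers i \subset U} ->
  {in T2, forall i, [disjoint readers i & U]} ->
  {in T1, forall i, #|readers i| <= d}%N ->
  (#|T1| <= 32 * 4 ^ d * m)%N.
Proof.
move=> T12 dT rT1 rT2 rd; have [F FP] := counting T12 dT rT1 rT2.
pose C (A : {set {i | i \in T1}}) :=
  [set j in U | g j (indic ((val @: A) :|: F))].
have := @card_code_bound R _ _ C (fun i => readers (val i)) d.
rewrite card_sig card_ord; apply.
- by move=> i; apply: rd; apply: valP.
- move=> i A j; rewrite !inE => ij; congr (_ && _); apply: eq_query => l lS.
  rewrite imsetU1 !inE; case: eqP => // li.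
  by rewrite -li lS in ij.
- move=> A B AB; rewrite -(card_imset A val_inj) -(card_imset B val_inj).
  have sub (X : {set {i | i \in T1}}) : val @: X \subset T1.
    by apply/subsetP => i /imsetP[x _ ->]; apply: valP.
  apply: FP => // j jU.
  by have := congr1 (fun X : {set _} => j \in X) AB; rewrite !inE jU.
Qed.

Let sum_readers : (\sum_i #|readers i| = m * k)%N.
Proof.
transitivity (\sum_i \sum_j (i \in S j : nat))%N.
  apply: eq_bigr => i _; rewrite -sum1_card big_mkcond /=.
  by apply: eq_bigr => j _; rewrite inE; case: (i \in S j).
rewrite exchange_big /= -[m in RHS]card_ord -sum_nat_const.
apply: eq_bigr => j _; rewrite -(Sk j) -sum1_card [RHS]big_mkcond /=.
by apply: eq_bigr => i _; case: (i \in S j).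
Qed.

Lemma composition_covers : (n <= m * k)%N.
Proof.
rewrite -sum_readers -[leqLHS]card_ord -sum1_card; apply: leq_sum => i _.
by rewrite card_gt0 readers_neq0.
Qed.

(** Separate the variables with few readers, shrink both groups to a common size [N], and apply
    [counting_bound]; the separation and the code each cost a power of [4 ^ d]. *)
Lemma composition_bound (R : realType) (d : nat) :
  (0 < n)%N -> (4 * (d * k) <= n)%N -> (2 * (m * k) < d.+1 * n)%N ->
  (n <= 256 * 16 ^ d * m)%N.
Proof.
move=> n0 dk md; pose D := [set i | #|readers i| <= d]%N.
(* Markov: the readers number [m * k] in total, and variables outside [D] have at least [d.+1]
   each. *)
have cD : (n <= 2 * #|D|)%N.
  have : (d.+1 * #|~: D| <= m * k)%N.
    rewrite -sum_readers mulnC -sum_nat_const [leqRHS](bigID (mem (~: D))) /=.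
    apply: leq_trans (leq_addr _ _); apply: leq_sum => i.
    by rewrite !inE -ltnNge.
  have := cardsC D; rewrite card_ord; nia.
have Dd : {in D, forall i, #|readers i| <= d}%N by move=> i; rewrite inE.
(* At most [d] functions read [i], and each reads [k] variables. *)
have De : {in D, forall i,
    #|[set i' in D | ~~ [disjoint readers i & readers i']]| <= d * k}%N.
  move=> i iD; apply: leq_trans (_ : \sum_(j in readers i) #|S j| <= _)%N.
    under eq_bigr do rewrite -sum1_card big_mkcond /=.
    rewrite exchange_big /= -sum1_card big_mkcond /=; apply: leq_sum => i' _.
    case: ifP => //; rewrite inE => /andP[_ /pred0Pn[j /= /andP[ji ji']]].
    by rewrite (bigD1 j) //=; move: ji'; rewrite inE => ->.
  by rewrite (eq_bigr (fun=> k)) ?sum_nat_const ?leq_mul2r ?Dd ?orbT.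
have [U] := exists_separator Dd De.
set T1 := [set i in D | _]; set T2 := [set i in D | _] => T12.
have dT : [disjoint T1 & T2].
  apply/pred0P => i /=; rewrite !inE; apply/negP.
  case/andP => /andP[_ sU] /andP[_ dU].
  have /set0Pn[j ji] := readers_neq0 i.
  by have := disjointFr dU ji; rewrite (subsetP sU).
pose N := minn #|T1| #|T2|.
have T1n : (#|T1| <= n)%N by rewrite -[leqRHS]card_ord max_card.
have T2n : (#|T2| <= n)%N by rewrite -[leqRHS]card_ord max_card.
have prodN : (#|T1| * #|T2| <= N * n)%N.
  by rewrite /N; case: (leqP #|T1| #|T2|) => _; nia.
have [V1 sV1 cV1] : exists2 V1 : {set 'I_n}, V1 \subset T1 & #|V1| = N.
  by apply: exists_subset_card; rewrite geq_minl.
have [V2 sV2 cV2] : exists2 V2 : {set 'I_n}, V2 \subset T2 & #|V2| = N.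
  by apply: exists_subset_card; rewrite geq_minr.
have NB : (N <= 32 * 4 ^ d * m)%N.
  rewrite -cV1; apply: (@counting_bound R d U V1 V2).
  - by rewrite cV1.
  - by rewrite (disjointWl sV1) // (disjointWr sV2).
  - by move=> i /(subsetP sV1); rewrite inE => /andP[].
  - by move=> i /(subsetP sV2); rewrite inE => /andP[].
  - by move=> i /(subsetP sV1); rewrite !inE => /andP[].
(* Here [#|D| >= n / 2] and [d * k <= n / 4], whence the factor 8. *)
have nn : (n * n <= 8 * 4 ^ d * N * n)%N.
  apply: leq_trans (_ : 8 * (#|D| * (#|D| - d * k)) <= _)%N; first by nia.
  by rewrite -!mulnA leq_mul2l (leq_trans T12) // leq_mul2l prodN orbT.
have {}nn : (n <= 8 * 4 ^ d * N)%N by rewrite -(leq_pmul2r n0).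
apply: (leq_trans nn); apply: leq_trans (_ : 8 * 4 ^ d * (32 * 4 ^ d * m) <= _)%N.
  by rewrite leq_mul2l NB orbT.
have -> : (16 ^ d = 4 ^ d * 4 ^ d)%N by rewrite -expnMn.
by nia.
Qed.

End MajorityComposition.

(** * Choice of parameters and the final bound *)

Theorem mainTheorem7 (R : realType) :
  exists c : R, 0 < c /\
    forall n k : nat, (0 < n)%N -> (0 < k)%N -> (k <= n)%N ->
      c * (n%:R / k%:R) *
        Num.min (log2 (k%:R : R)) (log2 (n%:R / k%:R : R))
      <= (CC k (@Maj n))%:R.
Proof.
(* The cases below bound the minimum by [8 * d <= 16 * w] and by [7 + 5 * d <= 17 * w], using
   [d <= 2 * w] and [1 <= w]. *)
exists 17^-1; split=> [|n k n0 k0 kn]; first by rewrite invr_gt0.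
have [|[g [h [gl gh]]] _] := @CC_is_minimum k n bool (@Maj n); first by rewrite k0.
move: (CC k (@Maj n)) g h gl gh => m g h gl gh.
have [S SP] := boolp.choice gl.
have Sk j : #|S j| = k by have [] := SP j.
have gS j : depends_only_on (S j) (g j) by have [] := SP j.
have cover := composition_covers gS Sk gh.
pose d := (2 * (m * k) %/ n)%N.
have dle : (d * n <= 2 * (m * k))%N by rewrite /d leq_divM.
have dlt : (2 * (m * k) < d.+1 * n)%N by rewrite /d ltn_ceil.
have kR : 0 < k%:R :> R by rewrite ltr0n.
have nR : 0 < n%:R :> R by rewrite ltr0n.
pose y : R := n%:R / k%:R.
have y0 : 0 < y by rewrite divr_gt0.
have my : m%:R = y * (m%:R * k%:R / n%:R) :> R.
  by rewrite /y; field; rewrite !gt_eqF.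
(* The average number of functions reading a variable; [d] is the integer part of its double. *)
set w : R := m%:R * k%:R / n%:R in my.
rewrite my -/y [17^-1 * y]mulrC -mulrA ler_pM2l //.
have ln20 : 0 < ln 2 :> R by rewrite ln_gt0 // ltr1n.
have w1 : 1 <= w by rewrite /w ler_pdivlMr // mul1r -natrM ler_nat.
have dw : d%:R <= 2 * w :> R.
  by rewrite /w mulrA ler_pdivlMr // -!natrM ler_nat.
have ln2_ge : 2^-1 <= ln 2 :> R.
  have := @le_ln1Dx R (- 2^-1); rewrite (_ : 1 - 2^-1 = 2^-1 :> R); last by lra.
  by rewrite lnV ?posrE // lerNl opprK; apply; lra.
have [dk|dk] := leqP (4 * (d * k)) n; last first.
  have yd : y <= 4 * d%:R.
    by rewrite /y ler_pdivrMr // -mulrA -!natrM ler_nat ltnW.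
  have log_y : log2 y <= 2 * y.
    rewrite /log2 ler_pdivrMr //; have := ln_sublinear y0; nra.
  have : Num.min (log2 k%:R) (log2 y) <= log2 y by rewrite ge_min lexx orbT.
  lra.
have nm := composition_bound gS Sk gh R n0 dk dlt.
have d2 : (d.+1 <= 2 ^ d)%N by exact: ltn_expl.
(* Multiplying [nm] by [k] and inserting [dlt] gives [k <= 128 * 16 ^ d * d.+1]. *)
have kd : (k <= 2 ^ (7 + 5 * d))%N.
  have -> : (2 ^ (7 + 5 * d) = 128 * (16 ^ d * 2 ^ d))%N.
    by rewrite expnD expnM -expnMn.
  rewrite -(leq_pmul2r n0); apply: leq_trans (_ : 128 * (16 ^ d * d.+1) * n <= _)%N.
    by have := leq_mul2l k n (256 * 16 ^ d * m); rewrite nm orbT; nia.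
  by rewrite leq_mul2r leq_mul2l leq_mul2l d2 !orbT.
have log_k : log2 k%:R <= 7 + 5 * d%:R :> R.
  rewrite /log2 ler_pdivrMr //.
  apply: le_trans (_ : ln ((2 ^ (7 + 5 * d))%:R) <= _).
    by rewrite ler_ln ?posrE ?ltr0n ?expn_gt0 // ler_nat.
  by rewrite natrX lnXn // -[leLHS]mulr_natl natrD natrM.
have : Num.min (log2 k%:R) (log2 y) <= log2 k%:R by rewrite ge_min lexx.
lra.
Qed.
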